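(* Let $H$ be a Hilbert space and let $\mathcal F(H)$ be the category of finite-dimensional subspaces of $H$ and linear maps. Then the bounded normal dual $B^*\mathcal F(H)$ of $\mathcal F(H)$ is a normal category, and the normal category $B^*\mathcal F(H)$ is isomorphic, as a normal category, to the normal category $\mathcal F(H')$ of finite-dimensional subspaces of the dual space $H'$ of $H$.
   Context: $H$ is a Hilbert space over $\mathbf K=\mathbb R$ or $\mathbb C$, and $H'$ is its (continuous) dual. Composition of maps, morphisms and functors is written from left to right ($fg$ means first $f$, then $g$). Category with subobjects: a small category $\mathcal C$ together with a subcategory $\mathcal P$ having the same objects, such that each hom-set of $\mathcal P$ has at most one morphism, the relation ''$p\subseteq p'$ iff $\mathcal P(p,p')\neq\varnothing$'' is a partial order, every morphism of $\mathcal P$ is a monomorphism of $\mathcal C$, and if $f=hg$ with $f,g\in\mathcal P$, $h\in\mathcal C$, then $h\in\mathcal P$. Morphisms of $\mathcal P$ are called inclusions; a right inverse in $\mathcal C$ of an inclusion is called a retraction. A normal factorization of $f$ is $f=quj$ with $q$ a retraction, $u$ an isomorphism, $j$ an inclusion; then $f^\circ=qu$ is the epimorphic component of $f$. Cone: a cone $\gamma$ with vertex $d=c_\gamma$ assigns to each object $c$ a morphism $\gamma(c):c\to d$ such that $\gamma(c')=j\gamma(c)$ whenever $j:c'\to c$ is an inclusion. It is a normal cone if some $\gamma(c)$ is an isomorphism. For an epimorphism $h:c_\gamma\to d'$, $\gamma\star h$ is the cone $c\mapsto\gamma(c)h$ with vertex $d'$. Normal category: a category with subobjects in which every morphism has a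 normal factorization, every inclusion splits (has a right inverse), and for each object $d$ there is a normal cone $\gamma$ with vertex $d$ and $\gamma(d)=1_d$. Normal cones in a normal category $\mathcal C$ form a semigroup $T\mathcal C$ under $(\gamma\cdot\delta)(c)=\gamma(c)(\delta(c_\gamma))^\circ$; $E(\cdot)$ denotes the set of idempotents. For a normal cone $\gamma$, the functor $H(\gamma,-):\mathcal C\to\mathbf{Set}$ is given by $H(\gamma,c)=\{\gamma\star f^\circ: f\in\mathcal C(c_\gamma,c)\}$ and $H(\gamma,g):\gamma\star f^\circ\mapsto\gamma\star(fg)^\circ$ for $g:c\to c'$. Two normal categories are isomorphic if there is an inclusion-preserving isomorphism of categories between them. $\mathcal F(H)$ has as objects the finite-dimensional subspaces of $H$, as morphisms all linear maps between them, and as inclusions the subspace inclusions; it is a normal category, and $f^\circ$ is $f$ corestricted to its range. $\mathcal F(H')$ is defined in the same way from $H'$. A normal cone $\gamma$ in $\mathcal F(H)$ is bounded if there is $\alpha_\gamma\in\mathbb R$ with $\|\gamma(M)\|\le\alpha_\gamma$ for all objects $M$; $B\mathcal F(H)$ is the set (a subsemigroup of $T\mathcal F(H)$) of bounded normal cones. The bounded normal dual $B^*\mathcal F(H)$ is the full subcategory of the category of all functors $\mathcal F(H)\to\mathbf{Set}$ (with natural transformations as morphisms) whose objects are the functors $H(\epsilon,-)$ with $\epsilon\in E(B\mathcal F(H))$. Its inclusions are the natural transformations $H(\epsilon,-)\to H(\epsilon',-)$ all of whose components are set inclusions. *)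

(* Defs.v *)
From HB Require Import structures.
From mathcomp Require Import all_boot all_order all_algebra.
From mathcomp Require Import complex.
From mathcomp Require Import all_classical all_reals all_analysis.

Set Implicit Arguments.
Unset Strict Implicit.
Unset Printing Implicit Defensive.

Import Order.TTheory GRing.Theory Num.Theory.
Import numFieldNormedType.Exports.

Local Open Scope classical_set_scope.
Local Open Scope ring_scope.

(* Composition is written from left to right: [f ;; g] is first f, then g.    *)
Record category := Category {
  ob :> Type;
  hom : ob -> ob -> Type;
  idm : forall a, hom a a;
  comp : forall a b c, hom a b -> hom b c -> hom a c;
  comp1m : forall a b (f : hom a b), comp (idm a) f = f;
  compm1 : forall a b (f : hom a b), comp f (idm b) = f;
  compmA : forall a b c d (f : hom a b) (g : hom b c) (h : hom c d),
    comp f (comp g h) = comp (comp f g) h }.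

Arguments hom {_} _ _.
Arguments idm {_} _.
Arguments comp {_ _ _ _} _ _.

Notation "f ;; g" := (comp f g) (at level 50, left associativity).

Section Morphisms.
Variable C : category.

Definition mono (b c : C) (m : hom b c) :=
  forall (a : C) (f g : hom a b), f ;; m = g ;; m -> f = g.

Definition iso (a b : C) (f : hom a b) :=
  exists g : hom b a, f ;; g = idm a /\ g ;; f = idm b.

End Morphisms.

Record functor (C D : category) := Functor {
  fob :> C -> D;
  fmap : forall a b : C, hom a b -> hom (fob a) (fob b);
  fmap1 : forall a, fmap (idm a) = idm (fob a);
  fmapM : forall (a b c : C) (f : hom a b) (g : hom b c),
    fmap (f ;; g) = fmap f ;; fmap g }.

Arguments fmap {_ _} _ {_ _} _.

Definition functor_id (C : category) : functor C C :=
  @Functor C C id (fun _ _ f => f) (fun=> erefl) (fun _ _ _ _ _ => erefl).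

Section FunctorComp.
Variables (C D E : category) (F : functor C D) (G : functor D E).

Let map (a b : C) (f : hom a b) : hom (G (F a)) (G (F b)) := fmap G (fmap F f).

Let map1 a : map (idm a) = idm (G (F a)).
Proof. by rewrite /map !fmap1. Qed.

Let mapM (a b c : C) (f : hom a b) (g : hom b c) :
  map (f ;; g) = map f ;; map g.
Proof. by rewrite /map !fmapM. Qed.

Definition functor_comp : functor C E := Functor map1 mapM.

End FunctorComp.

Definition cat_iso (C D : category) (F : functor C D) :=
  exists G : functor D C,
    functor_comp F G = functor_id C /\ functor_comp G F = functor_id D.

Section FunctorCategory.
Variables C D : category.

Record nat_trans (F G : functor C D) := NatTrans {
  component :> forall c : C, hom (F c) (G c);
  natural : forall (a b : C) (f : hom a b),
    fmap F f ;; component b = component a ;; fmap G f }.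

Lemma nat_transP (F G : functor C D) (s t : nat_trans F G) :
  (forall c, s c = t c) -> s = t.
Proof.
case: s t => [s sP] [t tP] /= st.
have {}st : s = t by apply: functional_extensionality_dep.
by case: _ / st in tP *; congr NatTrans; exact: Prop_irrelevance.
Qed.

Let nat_idP (F : functor C D) (a b : C) (f : hom a b) :
  fmap F f ;; idm (F b) = idm (F a) ;; fmap F f.
Proof. by rewrite comp1m compm1. Qed.

Definition nat_id (F : functor C D) : nat_trans F F := NatTrans (@nat_idP F).

Let nat_compP (F G L : functor C D) (s : nat_trans F G) (t : nat_trans G L)
    (a b : C) (f : hom a b) :
  fmap F f ;; (s b ;; t b) = (s a ;; t a) ;; fmap L f.
Proof. by rewrite compmA natural -!compmA natural. Qed.

Definition nat_comp (F G L : functor C D) (s : nat_trans F G)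
  (t : nat_trans G L) : nat_trans F L := NatTrans (nat_compP s t).

Definition functor_cat : category.
Proof.
apply: (@Category (functor C D) nat_trans nat_id nat_comp) => [F G s|F G s|].
- by apply: nat_transP => c /=; rewrite comp1m.
- by apply: nat_transP => c /=; rewrite compm1.
- by move=> F G L M s t u; apply: nat_transP => c /=; rewrite compmA.
Defined.

End FunctorCategory.

Definition full_subcat (C : category) (P : C -> Prop) : category :=
  @Category {a : C | P a} (fun a b => hom (sval a) (sval b))
    (fun a => idm (sval a)) (fun _ _ _ f g => f ;; g)
    (fun _ _ f => comp1m f) (fun _ _ f => compm1 f)
    (fun _ _ _ _ f g h => compmA f g h).

(* The full subcategory of Set on the subsets of a type T. The common ambient *)
(* type gives a meaning to set inclusions between its objects.                *)
Definition set_cat (T : Type) : category :=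
  @Category (set T) (fun A B => A -> B) (fun _ x => x) (fun _ _ _ f g x => g (f x))
    (fun _ _ _ => erefl) (fun _ _ _ => erefl) (fun _ _ _ _ _ _ _ => erefl).

(* [incl] is the class of morphisms of the subcategory of inclusions; its     *)
(* axioms are in [has_subobjects].                                            *)
Record incl_category := InclCategory {
  icat :> category;
  incl : forall a b : icat, hom a b -> Prop }.

Arguments incl {_ _ _} _.

Section Normal.
Variable C : incl_category.

(* The relation "there is an inclusion a -> b" is reflexive and transitive by *)
(* the first two clauses, so that only antisymmetry is required of it.        *)
Definition has_subobjects :=
  [/\ (forall a : C, incl (idm a)),
      (forall (a b c : C) (f : hom a b) (g : hom b c),
         incl f -> incl g -> incl (f ;; g)),
      (forall (a b : C) (f g : hom a b), incl f -> incl g -> f = g) &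
      (forall (a b : C) (f : hom a b) (g : hom b a),
         incl f -> incl g -> a = b)] /\
  [/\ (forall (a b : C) (f : hom a b), incl f -> mono f) &
      (forall (a b c : C) (h : hom a b) (g : hom b c),
         incl (h ;; g) -> incl g -> incl h)].

Definition retraction (a b : C) (q : hom a b) :=
  exists j : hom b a, incl j /\ j ;; q = idm b.

Definition normal_factorization (a b : C) (f : hom a b) (c d : C)
    (q : hom a c) (u : hom c d) (j : hom d b) :=
  [/\ retraction q, iso u, incl j & f = q ;; u ;; j].

Definition is_epi_component (a b : C) (f : hom a b) (e : {d : C & hom a d}) :=
  exists (c d : C) (q : hom a c) (u : hom c d) (j : hom d b),
    normal_factorization f q u j /\ e = existT (hom a) d (q ;; u).

(* The epimorphic component of f, packed with its codomain. It is unique when *)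
(* C has subobjects; the value (b, f) for an f without a normal factorization *)
(* is never used in a normal category.                                        *)
Definition epi_component (a b : C) (f : hom a b) : {d : C & hom a d} :=
  if pselect (exists e, is_epi_component f e) is left fe then projT1 (cid fe)
  else existT (hom a) b f.

Definition is_cone (d : C) (g : forall c : C, hom c d) :=
  forall (c' c : C) (j : hom c' c), incl j -> g c' = j ;; g c.

Record cone := Cone {
  vertex : C;
  cone_map :> forall c : C, hom c vertex;
  coneP : is_cone cone_map }.

Definition is_normal_cone (d : C) (g : forall c : C, hom c d) :=
  exists c : C, iso (g c).

Lemma is_cone_star (g : cone) (d : C) (h : hom (vertex g) d) :
  is_cone (fun c => g c ;; h).
Proof. by move=> c' c j /(coneP g) ->; rewrite compmA. Qed.

(* The operation is only applied to epimorphisms h, namely epimorphic         *)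
(* components, for which it preserves normality; any h yields a cone.         *)
Definition star (g : cone) (d : C) (h : hom (vertex g) d) : cone :=
  Cone (is_cone_star h).

Definition star_epi (g : cone) (c : C) (f : hom (vertex g) c) : cone :=
  star (projT2 (epi_component f)).

Definition cone_mul (g h : cone) : cone := star_epi (h (vertex g)).

Definition normal_category :=
  [/\ has_subobjects,
      (forall (a b : C) (f : hom a b), exists (c d : C) (q : hom a c)
         (u : hom c d) (j : hom d b), normal_factorization f q u j),
      (forall (a b : C) (j : hom a b), incl j ->
         exists q : hom b a, j ;; q = idm a) &
      (forall d : C, exists g : forall c : C, hom c d,
         [/\ is_cone g, is_normal_cone g & g d = idm d])].

(* F is the functor H(g, -). Its two clauses determine F, on objects and on   *)
(* morphisms.                                                                 *)
Definition is_H_functor (g : cone) (F : functor C (set_cat cone)) :=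
  (forall c : C, F c = [set star_epi f | f in [set: hom (vertex g) c]]) /\
  (forall (c c' : C) (k : hom c c') (f : hom (vertex g) c)
     (x : @set_type cone (F c)),
     val x = star_epi f -> val (fmap F k x) = star_epi (f ;; k)).

End Normal.

(* Between normal categories, the inverse of an inclusion-preserving          *)
(* isomorphism preserves inclusions as well.                                  *)
Definition normal_isomorphic (C D : incl_category) :=
  exists F : functor C D, cat_iso F /\
    forall (a b : C) (f : hom a b), incl f -> incl (fmap F f).

Section FinDim.
Variables (K : fieldType) (V : lmodType K).

Record fdspace := FdSpace {
  fd_set :> set V;
  fd_setP : exists (n : nat) (e : 'I_n -> V),
    fd_set = range (fun c : 'I_n -> K => \sum_(i < n) c i *: e i) }.

Definition fd_pred (M : fdspace) : {pred V} := fun v => v \in fd_set M.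

Lemma fd_pred_submod_closed (M : fdspace) : submod_closed (fd_pred M).
Proof.
case: M => M [n [e Me]]; rewrite /fd_pred; split=> /=.
  rewrite unfold_in /= Me; apply/mem_set; exists (fun=> 0) => //.
  by rewrite big1// => i _; rewrite scale0r.
move=> a u v; rewrite !unfold_in /= Me.
move=> /set_mem[c _ <-] /set_mem[d _ <-]; apply/mem_set.
exists (fun i => a * c i + d i) => //.
rewrite scaler_sumr -big_split; apply: eq_bigr => i _.
by rewrite scalerDl scalerA.
Qed.

HB.instance Definition _ (M : fdspace) :=
  GRing.isSubmodClosed.Build K V (fd_pred M) (fd_pred_submod_closed M).

Record fd_type (M : fdspace) := FdType {
  fd_val : V;
  _ : fd_val \in fd_pred M }.

HB.instance Definition _ (M : fdspace) := [isSub for @fd_val M].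
HB.instance Definition _ (M : fdspace) := [Choice of fd_type M by <:].
HB.instance Definition _ (M : fdspace) :=
  [SubChoice_isSubLmodule of fd_type M by <:].

End FinDim.

Section FinDimCategory.
Variables (K : fieldType) (V : lmodType K).

Lemma linear_ext (U W : lmodType K) (f g : {linear U -> W}) : f =1 g -> f = g.
Proof.
case: f g => [f [[fA] [fB]]] [g [[gA] [gB]]] /= /funext fg.
case: _ / fg in gA gB *.
by rewrite (Prop_irrelevance fA gA) (Prop_irrelevance fB gB).
Qed.

Definition fd_cat : category.
Proof.
apply: (@Category (fdspace V) (fun M N => {linear fd_type M -> fd_type N})
  (fun M => idfun : {linear fd_type M -> fd_type M})
  (fun M N P f g => g \o f : {linear fd_type M -> fd_type P})) => *;
  exact: linear_ext.
Defined.

Definition fd_incl (M N : fd_cat) (f : hom M N) :=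
  forall x, val ((f : {linear fd_type M -> fd_type N}) x) = val x.

Definition fd_icat : incl_category := @InclCategory fd_cat fd_incl.

End FinDimCategory.

Section BoundedNormalDual.
Variables (K : numFieldType) (V : normedModType K).

Notation FV := (fd_icat V).

(* This says ||f|| <= a for the operator norm ||f|| = sup {|f x| : |x| <= 1}. *)
Definition opnorm_le (M N : fdspace V) (f : {linear fd_type M -> fd_type N})
    (a : K) :=
  forall x : fd_type M, `|val x| <= 1 -> `|val (f x)| <= a.

Definition bounded_cone (g : cone FV) :=
  exists2 a : K, a \is Num.real & forall M : FV, opnorm_le (g M) a.

Definition is_bounded_dual_ob (F : functor FV (set_cat (cone FV))) :=
  exists e : cone FV,
    [/\ is_normal_cone e, bounded_cone e, cone_mul e e = e & is_H_functor e F].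

Definition bounded_dual_cat : category :=
  full_subcat (C := functor_cat FV (set_cat (cone FV))) is_bounded_dual_ob.

Definition bounded_dual_incl (F G : bounded_dual_cat) (s : hom F G) :=
  forall (M : FV) (x : set_type (sval F M)), val (s M x) = val x.

Definition bounded_dual : incl_category :=
  @InclCategory bounded_dual_cat bounded_dual_incl.

End BoundedNormalDual.

Section Dual.
Variables (K : numFieldType) (V : normedModType K).

Definition dual_pred : {pred V -> K^o} :=
  fun f => `[< linear f /\ continuous f >].

Lemma dual_pred_submod_closed : submod_closed dual_pred.
Proof.
split.
  apply/asboolP; split=> [a u v|]; first by rewrite /= scaler0 addr0.
  exact: cst_continuous.
move=> a f g /asboolP[fl fc] /asboolP[gl gc]; apply/asboolP; split.
  move=> b u v; change (a *: f (b *: u + v) + g (b *: u + v) =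
    b *: (a *: f u + g u) + (a *: f v + g v)).
  by rewrite fl gl !scalerDr !scalerA (mulrC a b) addrACA.
by move=> x; apply: cvgD; [apply: cvgZ; [exact: cvg_cst|exact: fc]|exact: gc].
Qed.

HB.instance Definition _ :=
  GRing.isSubmodClosed.Build K (V -> K^o) dual_pred dual_pred_submod_closed.

Record dual := Dual {
  dual_fun :> V -> K^o;
  _ : dual_fun \in dual_pred }.

HB.instance Definition _ := [isSub for dual_fun].
HB.instance Definition _ := [Choice of dual by <:].
HB.instance Definition _ := [SubChoice_isSubLmodule of dual by <:].

End Dual.

(* [theta] is the identity for real scalars and the conjugation for complex   *)
(* ones; [hilb_dot] is linear in its first argument.                          *)
Record hilbert (K : numFieldType) (theta : K -> K) := Hilbert {
  hilb_space :> completeNormedModType K;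
  hilb_dot : {dot hilb_space for theta};
  hilb_norm : forall x : hilb_space, `|x| ^+ 2 = hilb_dot x x }.

Definition real_hilbert (R : realType) := hilbert (@idfun R).
Definition complex_hilbert (R : realType) := hilbert (@Num.conj R[i]).

(* Main.v *)
Require Import Defs.
From HB Require Import structures.
From mathcomp Require Import all_boot all_order all_algebra.
From mathcomp Require Import all_classical all_reals all_analysis.
From Stdlib Require Import Eqdep.
Import Defs.

Set Implicit Arguments.
Unset Strict Implicit.
Unset Printing Implicit Defensive.

Import Order.TTheory GRing.Theory Num.Theory.
Import numFieldNormedType.Exports.

Local Open Scope classical_set_scope.
Local Open Scope ring_scope.

(** The theorem holds for every normed space V whose continuous dual V'
    separates points; a Hilbert space has this property because x is detected
    by the functional <-, x>, which is continuous by Cauchy-Schwarz.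

    A cone in F(V) glues to one linear map on V, its total map, of finite rank.
    A normal cone is onto its vertex, hence is determined by its total map;
    products of cones become composites, idempotents become projections, and
    bounded cones become continuous maps. For a projection e, the set H(e, c)
    consists of the onto cones with values in c that factor through e. Such a
    cone g is known from its coordinates, the functionals psi g with psi in V',
    and the coordinates of the cones of H(e, -) form the finite-dimensional
    subspace N of V' of the functionals fixed by precomposition with e
    ([coordsE]). In other words H(e, -) is the tensor product of N with the
    forgetful functor.

    The isomorphism sends H(e, -) to N. On objects it is injective because N
    determines H(e, -) ([bounded_dual_mem]) and surjective because each N is the
    coordinate space of a projection built from a basis of N and a dual family
    in V ([coord_space_surj]). On morphisms it relates s : H(e, -) -> H(e', -)
    to t : N -> N' when t acts on coordinates as s acts on cones
    ([transposes]). By the Yoneda lemma s is precomposition by an operator T of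
    V, and so t is precomposition by T; conversely every t is precomposition
    by an operator of finite rank. Since V' separates points, s and t determine
    each other, and one is an inclusion exactly when the other is.

    It remains to see that F(V') is a normal category, and to transport this
    back along the isomorphism. Both this and the construction of projections
    above rest on biorthogonal systems ([biorthogonal_fdspace]): given a pairing
    of V with W for which W separates the points of V, every finite-dimensional
    subspace of V has a basis with a dual family in W. This is applied to V
    paired with V' and to V' paired with V. *)

(** * Isomorphisms of categories *)

Lemma cid_fun (A : Type) (B : A -> Type) (P : forall a, B a -> Prop) :
  (forall a, exists b, P a b) -> {f : forall a, B a | forall a, P a (f a)}.
Proof.
by move=> PE; exists (fun a => projT1 (cid (PE a))) => a; case: cid.
Qed.

(** Equalities between morphisms with different endpoints are stated in this
    type of all morphisms, so that no transport has to be written. *)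
Definition arrow (C : category) := {p : C * C & hom p.1 p.2}.

Definition arr (C : category) (a b : C) (f : hom a b) : arrow C :=
  existT (fun p : C * C => hom p.1 p.2) (a, b) f.

Lemma arr_inj (C : category) (a b : C) (f g : hom a b) : arr f = arr g -> f = g.
Proof. exact: inj_pair2. Qed.

Lemma arr_dom (C : category) (a b a' b' : C) (f : hom a b) (g : hom a' b') :
  arr f = arr g -> a = a' /\ b = b'.
Proof. by move=> fg; split; [have := congr1 (fun u => (projT1 u).1) fg|
  have := congr1 (fun u => (projT1 u).2) fg]. Qed.

Lemma functor_ext (C D : category) (F G : functor C D) :
  (forall (a b : C) (f : hom a b), arr (fmap F f) = arr (fmap G f)) -> F = G.
Proof.
case: F G => [F Fm F1 FM] [G Gm G1 GM] /= FG.
have FGo : F = G.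
  by apply/funext => a; have [] := arr_dom (FG a a (idm a)).
case: _ / FGo in Gm G1 GM FG *.
have FGm : Fm = Gm.
  do 3 (apply: functional_extensionality_dep => ?); exact/arr_inj/FG.
case: _ / FGm in G1 GM FG *.
by congr Functor; exact: Prop_irrelevance.
Qed.

Definition fully_bijective (C D : category) (F : functor C D) :=
  [/\ injective (fob F), (forall d, exists c, F c = d),
      (forall a b : C, injective (@fmap _ _ F a b)) &
      (forall (a b : C) (g : hom (F a) (F b)), exists f, fmap F f = g)].

Section FullyBijective.
Variables (C D : category) (F : functor C D).
Hypothesis FP : fully_bijective F.

Let arrF_inj (a b a' b' : C) (f : hom a b) (f' : hom a' b') :
  arr (fmap F f) = arr (fmap F f') -> arr f = arr f'.
Proof.
case: FP => oinj _ minj _ e; have [/oinj ea /oinj eb] := arr_dom e.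
case: _ / ea in f' e *; case: _ / eb in f' e *.
by move/arr_inj/minj : e => ->.
Qed.

(** The inverse is chosen, object by object and morphism by morphism; its
    functoriality is checked after applying [F], which is faithful. *)
Lemma cat_iso_of_bij : cat_iso F.
Proof.
have [oinj osurj minj msurj] := FP.
have [g gP] := cid_fun osurj.
have lift_ex (p : {p : D * D & hom p.1 p.2}) :
    exists h : hom (g (projT1 p).1) (g (projT1 p).2), arr (fmap F h) = p.
  case: p => -[d d'] /= k; move: (gP d) (gP d') k.
  move: (g d) (g d') => a b ea eb; case: _ / ea; case: _ / eb => k.
  by have [f <-] := msurj _ _ k; exists f.
have [lift liftP] := cid_fun lift_ex.
pose gm (d d' : D) (k : hom d d') : hom (g d) (g d') := lift (arr k).
have gmP (d d' : D) (k : hom d d') : arr (fmap F (gm d d' k)) = arr k.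
  exact: liftP (arr k).
have arrM (a b c a' b' c' : D) (k : hom a b) (l : hom b c)
    (k' : hom a' b') (l' : hom b' c') :
    arr k = arr k' -> arr l = arr l' -> arr (k ;; l) = arr (k' ;; l').
  move=> ek el; have [ea eb] := arr_dom ek; have [_ ec] := arr_dom el.
  case: _ / ea in k' ek *; case: _ / eb in k' l' ek el *.
  case: _ / ec in l' el *.
  by rewrite (arr_inj ek) (arr_inj el).
have gm1 d : gm d d (idm d) = idm (g d).
  apply/arr_inj/arrF_inj; rewrite gmP fmap1.
  by rewrite gP.
have gmM (a b c : D) (k : hom a b) (l : hom b c) :
    gm a c (k ;; l) = gm a b k ;; gm b c l.
  by apply/arr_inj/arrF_inj; rewrite gmP fmapM; apply: arrM; rewrite gmP.
exists (Functor gm1 gmM); split; apply: functor_ext => a b f /=.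
- by apply: arrF_inj; rewrite gmP.
- by rewrite gmP.
Qed.

End FullyBijective.

(** A one-to-one correspondence between hom-sets can be specified by a relation
    instead of a formula: functoriality then amounts to compatibility of the
    relation with identities and composition. *)
Lemma functor_of_relation (C D : incl_category) (F : C -> D)
    (R : forall a b : C, hom a b -> hom (F a) (F b) -> Prop) :
  injective F -> (forall d, exists c, F c = d) ->
  (forall a b (f : hom a b), exists g, R a b f g) ->
  (forall a b (f : hom a b) g g', R a b f g -> R a b f g' -> g = g') ->
  (forall a b (g : hom (F a) (F b)), exists f, R a b f g) ->
  (forall a b (f f' : hom a b) g, R a b f g -> R a b f' g -> f = f') ->
  (forall a, R a a (idm a) (idm (F a))) ->
  (forall a b c (f : hom a b) (f' : hom b c) g g',
     R a b f g -> R b c f' g' -> R a c (f ;; f') (g ;; g')) ->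
  (forall a b (f : hom a b) g, R a b f g -> incl g <-> incl f) ->
  exists2 G : functor C D, fully_bijective G &
    forall (a b : C) (f : hom a b), incl (fmap G f) <-> incl f.
Proof.
move=> oinj osurj Rtot Runi Rsurj Rinj R1 RM Rincl.
have Rtot' (x : arrow C) :
  exists g, R (projT1 x).1 (projT1 x).2 (projT2 x) g by exact: Rtot.
have [m mP] := cid_fun Rtot'.
pose fm (a b : C) (f : hom a b) : hom (F a) (F b) := m (arr f).
have fmP (a b : C) (f : hom a b) : R a b f (fm a b f) by exact: mP (arr f).
have fm1 a : fm a a (idm a) = idm (F a) by exact: Runi (fmP _ _ _) (R1 a).
have fmM (a b c : C) (f : hom a b) (g : hom b c) :
    fm a c (f ;; g) = fm a b f ;; fm b c g.
  exact: Runi (fmP _ _ _) (RM _ _ _ _ _ _ _ (fmP _ _ _) (fmP _ _ _)).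
exists (Functor fm1 fmM) => [|a b f]; last exact: Rincl (fmP _ _ f).
split => //=.
- by move=> a b f f' /= e; apply: Rinj (fmP _ _ f) _; rewrite e; exact: fmP.
- move=> a b g; have [f fg] := Rsurj _ _ g; exists f.
  exact: Runi (fmP _ _ _) fg.
Qed.

(** * Transport of normality along an isomorphism *)

Section NormalTransport.
Variables (C D : incl_category) (F : functor C D).
Hypothesis FP : fully_bijective F.
Hypothesis Fincl : forall (a b : C) (f : hom a b), incl (fmap F f) <-> incl f.

Let surj_ob (P : D -> Prop) : (exists d, P d) -> exists c, P (F c).
Proof.
case: FP => _ osurj _ _ [d Pd]; have [c cd] := osurj d.
by exists c; rewrite cd.
Qed.

Let surj_hom (a b : C) (P : hom (F a) (F b) -> Prop) :
  (exists g, P g) -> exists f, P (fmap F f).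
Proof.
case: FP => _ _ _ msurj [g Pg]; have [f fg] := msurj _ _ g.
by exists f; rewrite fg.
Qed.

Let inj_hom (a b : C) (f g : hom a b) : fmap F f = fmap F g -> f = g.
Proof. by case: FP => _ _ minj _ /minj. Qed.

Let iso_fmap (a b : C) (f : hom a b) : iso (fmap F f) -> iso f.
Proof.
move=> /surj_hom[g [fg gf]]; exists g; split; apply: inj_hom;
  by rewrite fmapM fmap1.
Qed.

Let retraction_fmap (a b : C) (q : hom a b) :
  retraction (fmap F q) -> retraction q.
Proof.
move=> /surj_hom[j [/Fincl jI jq]]; exists j; split=> //.
by apply: inj_hom; rewrite fmapM fmap1.
Qed.

Lemma normal_transport : normal_category D -> normal_category C.
Proof.
case=> -[[i1 iM iU iA] [imono ifact]] nf isp ncone; split.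
- split; split.
  + by move=> a; apply/Fincl; rewrite fmap1.
  + move=> a b c f g /Fincl fI /Fincl gI.
    by apply/Fincl; rewrite fmapM; exact: iM.
  + by move=> a b f g /Fincl fI /Fincl gI; exact/inj_hom/iU.
  + move=> a b f g /Fincl fI /Fincl gI.
    by case: FP => oinj _ _ _; exact: oinj (iA _ _ _ _ fI gI).
  + move=> a b m /Fincl/imono mM c f g fg; apply/inj_hom/mM.
    by rewrite -!fmapM fg.
  + move=> a b c h g /Fincl; rewrite fmapM => hgI /Fincl gI.
    by apply/Fincl; exact: ifact hgI gI.
- move=> a b f; have /surj_ob[c /surj_ob[d]] := nf _ _ (fmap F f).
  move=> /surj_hom[q /surj_hom[u /surj_hom[j [qR uI jI fE]]]].
  exists c, d, q, u, j; split.
  + exact: retraction_fmap.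
  + exact: iso_fmap.
  + exact/Fincl.
  + by apply: inj_hom; rewrite !fmapM.
- move=> a b j /Fincl/isp/surj_hom[q qE]; exists q.
  by apply: inj_hom; rewrite fmapM fmap1.
- move=> d; have [g [gC gN g1]] := ncone (F d).
  have gE (c : C) : exists h : hom c d, fmap F h = g (F c).
    by case: FP => _ _ _ msurj; exact: msurj.
  have [h hE] := cid_fun gE; exists h; split.
  + by move=> c' c j /Fincl/gC gj; apply: inj_hom; rewrite fmapM !hE.
  + have /surj_ob[c] : exists c, iso (g c) by [].
    by rewrite -hE => /iso_fmap; exists c.
  + by apply: inj_hom; rewrite hE g1 fmap1.
Qed.

End NormalTransport.

(** * Finite-dimensional subspaces *)

Lemma linear_pack (K : fieldType) (U W : lmodType K) (f : U -> W) :
  linear f -> exists g : {linear U -> W}, g =1 f.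
Proof.
move=> fl; pose fm := GRing.isLinear.Build K U W _ f fl.
by exists (HB.pack_for {linear U -> W} f fm).
Qed.

Lemma linear_comb (K : fieldType) (U W : lmodType K) (f : {linear U -> W}) n
    (c : 'I_n -> K) (x : 'I_n -> U) :
  f (\sum_(i < n) c i *: x i) = \sum_(i < n) c i *: f (x i).
Proof. by rewrite linear_sum; apply: eq_bigr => i _; rewrite linearZ. Qed.

Definition fd_span (K : fieldType) (V : lmodType K) n (e : 'I_n -> V) :
  fdspace V := FdSpace (ex_intro _ n (ex_intro _ e erefl)).

Section FdSpace.
Variables (K : fieldType) (V : lmodType K).
Implicit Types M N : fdspace V.

Lemma fd_mem M (x : fd_type M) : fd_set M (val x).
Proof. by case: x => x /= /set_mem. Qed.

Lemma fd_mk M v : fd_set M v -> exists x : fd_type M, val x = v.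
Proof.
by move=> Mv; exists (FdType (mem_set Mv : v \in fd_pred M)).
Qed.

Lemma fdspace_eq M N : fd_set M = fd_set N -> M = N.
Proof.
case: M N => [M Mf] [N Nf] /= MN; case: _ / MN in Nf *.
by congr FdSpace; exact: Prop_irrelevance.
Qed.

Lemma fd_val_linear M : linear (val : fd_type M -> V).
Proof. by move=> a x y; rewrite linearP. Qed.

Lemma fd_val_comb M n (c : 'I_n -> K) (x : 'I_n -> fd_type M) :
  val (\sum_(i < n) c i *: x i) = \sum_(i < n) c i *: val (x i).
Proof. exact: linear_comb. Qed.

Lemma fd_linear_comb M (a : K) u v : fd_set M u -> fd_set M v ->
  fd_set M (a *: u + v).
Proof.
by move=> /fd_mk[x <-] /fd_mk[y <-]; rewrite -fd_val_linear; exact: fd_mem.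
Qed.

Lemma fd_map_ex (U : lmodType K) M (L : U -> V) :
  linear L -> (forall x, fd_set M (L x)) ->
  exists f : {linear U -> fd_type M}, forall x, val (f x) = L x.
Proof.
move=> Ll LM; have [f fL] := cid_fun (fun x => fd_mk (LM x)).
have fl : linear f.
  by move=> a x y; apply: val_inj; rewrite fd_val_linear !fL Ll.
by have [g gf] := linear_pack fl; exists g => x; rewrite gf.
Qed.

Lemma fd_image (W : lmodType K) M (L : {linear fd_type M -> W}) :
  exists N : fdspace W, fd_set N = range L.
Proof.
have [n [e Me]] := fd_setP M.
have eM i : exists x : fd_type M, val x = e i.
  apply: fd_mk; rewrite Me; exists (fun j => (j == i)%:R) => //.
  rewrite (bigD1 i)//= eqxx scale1r big1 ?addr0// => j /negPf ->.
  by rewrite scale0r.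
have {eM}[x xe] := cid_fun eM.
exists (fd_span (fun i => L (x i))); apply/seteqP; split => y /=.
  move=> [c _ <-]; exists (\sum_(i < n) c i *: x i) => //.
  exact: linear_comb.
move=> [m _ <-]; have := fd_mem m; rewrite Me => -[c _ cm].
exists c => //; rewrite -linear_comb.
congr (L _); apply: val_inj; rewrite -cm fd_val_comb.
by apply: eq_bigr => i _; rewrite xe.
Qed.

End FdSpace.

(** * Biorthogonal systems *)

Section Pairing.
Variables (K : fieldType) (V W : lmodType K).
Variable b : {bilinear W -> V -> K | *%R & *%R}.

(** The second clause makes [e] a basis of [M], since by the first one its
    members satisfy the equation; [w] then gives the coordinates. *)
Definition biorthogonal (M : set V) n (e : 'I_n -> V) (w : 'I_n -> W) :=
  (forall i j, b (w i) (e j) = (i == j)%:R) /\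
  (forall x, M x <-> x = \sum_(i < n) b (w i) x *: e i).

Lemma biorthogonal_basis M n (e : 'I_n -> V) (w : 'I_n -> W) :
  biorthogonal M e w -> forall i, M (e i).
Proof.
move=> [we MP] i; apply/MP; rewrite (bigD1 i)//= we eqxx scale1r big1 ?addr0//.
by move=> j /negPf ji; rewrite we ji scale0r.
Qed.

Let proj n (e : 'I_n -> V) (w : 'I_n -> W) x := \sum_(i < n) b (w i) x *: e i.

Lemma proj_linear n (e : 'I_n -> V) (w : 'I_n -> W) :
  linear (fun x => \sum_(i < n) b (w i) x *: e i).
Proof.
move=> a x y; rewrite scaler_sumr -big_split; apply: eq_bigr => i _ /=.
by rewrite linearPr scalerDl scalerA.
Qed.

Lemma pairing_comb w n (c : 'I_n -> K) (e : 'I_n -> V) :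
  b w (\sum_(i < n) c i *: e i) = \sum_(i < n) c i * b w (e i).
Proof. by rewrite linear_sumr; apply: eq_bigr => i _; rewrite linearZr_LR. Qed.

Lemma comb_pairing x n (c : 'I_n -> K) (w : 'I_n -> W) :
  b (\sum_(i < n) c i *: w i) x = \sum_(i < n) c i * b (w i) x.
Proof. by rewrite linear_sumlz; apply: eq_bigr => i _; rewrite linearZl_LR. Qed.

Lemma sum_delta (A : lmodType K) n (c : 'I_n -> A) (i : 'I_n) :
  \sum_(j < n) (i == j)%:R *: c j = c i.
Proof.
rewrite (bigD1 i)//= eqxx scale1r big1 ?addr0// => j.
by rewrite eq_sym => /negPf ->; rewrite scale0r.
Qed.

Lemma biorthogonal_coord n (e : 'I_n -> V) (w : 'I_n -> W) (c : 'I_n -> K) i :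
  (forall i j, b (w i) (e j) = (i == j)%:R) ->
  b (w i) (\sum_(j < n) c j *: e j) = c i.
Proof.
move=> we; rewrite pairing_comb -[RHS](@sum_delta K^o).
by apply: eq_bigr => j _; rewrite we mulrC.
Qed.

Hypothesis separated : forall x, (forall w, b w x = 0) -> x = 0.

(** Gram-Schmidt for a pairing: the remainder [v'] of the new vector, if not
    zero, is detected by some [u]; correcting [u] by the system already built
    keeps the new functional zero on the old vectors. *)
Lemma biorthogonal_span n (e : 'I_n -> V) :
  exists m (f : 'I_m -> V) (w : 'I_m -> W), biorthogonal (fd_span e) f w.
Proof.
elim: n e => [|n IH] e.
  exists 0%N, (fun=> 0), (fun=> 0); split=> [[]//|x]; rewrite big_ord0.
  split=> [[c _ <-]|->]; first by rewrite big_ord0.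
  by exists (fun=> 0) => //; rewrite big_ord0.
have [m [f [w [wf spanP]]]] := IH (fun i => e (lift ord0 i)).
pose v := e ord0; pose v' := v - proj f w v.
have projK x : proj f w (proj f w x) = proj f w x.
  by apply: eq_bigr => i _; rewrite biorthogonal_coord.
have projP a x y : proj f w (a *: x + y) = a *: proj f w x + proj f w y.
  exact: proj_linear.
have spanE x : fd_set (fd_span e) x <->
    exists a y, x = a *: v + y /\ y = proj f w y.
  split=> [[c _ <-]|[a [y [-> /spanP[c _ <-]]]]].
    exists (c ord0), (\sum_(i < n) c (lift ord0 i) *: e (lift ord0 i)).
    rewrite big_ord_recl; split=> //; apply/spanP.
    by exists (fun i => c (lift ord0 i)).
  exists (fun i => if unlift ord0 i is Some j then c j else a) => //.
  rewrite big_ord_recl unlift_none; congr (_ + _); apply: eq_bigr => i _.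
  by rewrite liftK.
have [v'0|v'N0] := pselect (v' = 0).
  exists m, f, w; split=> // x; rewrite spanE; split=> [[a [y [-> yP]]]|xP].
    have vP : v = proj f w v by apply/eqP; rewrite -subr_eq0 -/v' v'0.
    change (a *: v + y = proj f w (a *: v + y)).
    by rewrite projP -vP -yP.
  by exists 0, x; rewrite scale0r add0r.
have [u uN0] : exists u, b u v' != 0.
  apply: contrapT => /forallNP uP; apply/v'N0/separated => u.
  by apply/eqP/negbNE/negP; exact: uP.
have wv' i : b (w i) v' = 0.
  by rewrite linearBr /= biorthogonal_coord// subrr.
pose u1 := (b u v')^-1 *: u.
pose w0 := u1 - \sum_(i < m) b u1 (f i) *: w i.
have w0f j : b w0 (f j) = 0.
  rewrite linearBl /= comb_pairing.
  rewrite (eq_bigr (fun i => (j == i)%:R *: (b u1 (f i) : K^o))); last first.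
    by move=> i _; rewrite wf mulrC eq_sym.
  by rewrite sum_delta subrr.
have w0v' : b w0 v' = 1.
  rewrite linearBl /= comb_pairing big1 => [|i _]; last by rewrite wv' mulr0.
  by rewrite subr0 linearZl_LR /= mulVf.
have w0proj x : b w0 (proj f w x) = 0.
  by rewrite pairing_comb big1// => i _; rewrite w0f mulr0.
have w0v : b w0 v = 1.
  by rewrite -(subrK (proj f w v) v) -/v' linearDr /= w0v' w0proj addr0.
exists m.+1, (fun i => if unlift ord0 i is Some j then f j else v').
exists (fun i => if unlift ord0 i is Some j then w j else w0); split.
  move=> i j.
  case: (unliftP ord0 i) => [i'|] ->; case: (unliftP ord0 j) => [j'|] ->.
  - by rewrite wf (inj_eq lift_inj).
  - by rewrite wv'.
  - by rewrite w0f.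
  - by rewrite w0v' eqxx.
move=> x; rewrite big_ord_recl unlift_none.
under eq_bigr do rewrite liftK.
rewrite -/(proj f w x) spanE; split=> [[a [y [-> yP]]]|xE].
  have -> : b w0 (a *: v + y) = a.
    by rewrite linearPr /= w0v yP w0proj addr0 mulr1.
  by rewrite projP -yP /v' addrA scalerBr subrK.
exists (b w0 x), (proj f w (- b w0 x *: v + x)); split; last by rewrite projK.
by rewrite projP {1}xE /v' scalerBr scaleNr addrA.
Qed.

Lemma biorthogonal_fdspace (M : fdspace V) :
  exists m (f : 'I_m -> V) (w : 'I_m -> W), biorthogonal M f w.
Proof.
have [n [e Me]] := fd_setP M.
have -> : M = fd_span e by exact: fdspace_eq.
exact: biorthogonal_span.
Qed.

(** The coordinates extend from [M] to [V], as they are given by elements of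
    [W]: no choice of a complement of [M] is involved. *)
Lemma fd_projection (M : fdspace V) :
  exists p : {linear V -> fd_type M}, forall x : fd_type M, p (val x) = x.
Proof.
have [n [e [w ew]]] := biorthogonal_fdspace M.
have [|p pE] := @fd_map_ex _ _ _ M _ (proj_linear e w).
  move=> x; apply/ew.2; apply: eq_bigr => i _.
  by rewrite (biorthogonal_coord _ _ ew.1).
by exists p => x; apply: val_inj; rewrite pE -(ew.2 (val x)).1//; exact: fd_mem.
Qed.

End Pairing.

(** * The category of finite-dimensional subspaces *)

Section FdCategory.
Variables (K : fieldType) (V : lmodType K).
Implicit Types M N P : fd_icat V.

Definition app M N (f : hom M N) : {linear fd_type M -> fd_type N} := f.

Lemma app_comp M N P (f : hom M N) (g : hom N P) x :
  app (f ;; g) x = app g (app f x).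
Proof. by []. Qed.

Lemma app_id M x : app (idm M) x = x.
Proof. by []. Qed.

Lemma app_ext M N (f g : hom M N) :
  (forall x, val (app f x) = val (app g x)) -> f = g.
Proof. by move=> fg; apply: linear_ext => x; exact/val_inj/fg. Qed.

Lemma app_ex M N (L : fd_type M -> V) :
  linear L -> (forall x, fd_set N (L x)) ->
  exists f : hom M N, forall x, val (app f x) = L x.
Proof. by move=> Ll LN; have [f fL] := fd_map_ex Ll LN; exists f. Qed.

Lemma incl_ex M N : (forall v, fd_set M v -> fd_set N v) ->
  exists j : hom M N, incl j.
Proof.
move=> MN; have [|j jE] := @app_ex M N val (@fd_val_linear _ _ M).
  by move=> x; exact/MN/fd_mem.
by exists j.
Qed.

Lemma incl_app M N (j : hom M N) x : incl j -> val (app j x) = val x.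
Proof. exact. Qed.

Lemma iso_surj M N (f : hom M N) : iso f -> forall y, exists x, app f x = y.
Proof.
by move=> [g [_ gf]] y; exists (app g y); rewrite -app_comp gf app_id.
Qed.

(** The epimorphic component is the corestriction to the range, whichever normal
    factorization is used. *)
Lemma is_epi_component_app M N (f : hom M N) e : is_epi_component f e ->
  fd_set (projT1 e) = range (fun x => val (app f x)) /\
  forall x, val (app (projT2 e) x) = val (app f x).
Proof.
move=> [c [d [q [u [j [[[i [_ iq]] uI jI fE] ->]]]]]] /=.
have quE x : val (app (q ;; u) x) = val (app f x).
  by rewrite fE !app_comp (incl_app _ jI).
split=> //; apply/seteqP; split=> [v /fd_mk[y <-]|_ [x _ <-]] /=.
  have [z <-] := iso_surj uI y; exists (app i z) => //.
  by rewrite -quE -app_comp compmA iq comp1m.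
by rewrite -quE; exact: fd_mem.
Qed.

Lemma fd_subobjects : has_subobjects (fd_icat V).
Proof.
split; split.
- by [].
- by move=> M N P f g fI gI x; rewrite -[RHS](fI x) -[RHS]gI.
- move=> M N f g fI gI; apply: app_ext => x.
  by rewrite (incl_app _ fI) (incl_app _ gI).
- move=> M N f g fI gI; apply/fdspace_eq/seteqP; split=> v /fd_mk[x <-].
    by rewrite -(incl_app x fI); exact: fd_mem.
  by rewrite -(incl_app x gI); exact: fd_mem.
- move=> M N m mI P f g fg; apply: app_ext => x.
  by rewrite -!(incl_app _ mI) -!app_comp fg.
- move=> M N P h g hgI gI x; rewrite -[RHS](incl_app _ hgI) app_comp.
  by rewrite (incl_app _ gI).
Qed.

Variables (W : lmodType K) (b : {bilinear W -> V -> K | *%R & *%R}).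
Hypothesis separated : forall x, (forall w, b w x = 0) -> x = 0.

(** Choosing preimages [x] of a basis [y] of the range identifies the range
    with the span [c] of [x], a complement of the kernel; the retraction onto
    [c] is the projection along the kernel. *)
Lemma fd_normal_factorization M N (f : hom M N) :
  exists (c d : fd_icat V) (q : hom M c) (u : hom c d) (j : hom d N),
    normal_factorization f q u j.
Proof.
have [g0 g0E] := linear_pack (@fd_val_linear _ _ N).
have [d dE] := @fd_image _ _ _ M (g0 \o app f : {linear fd_type M -> V}).
have {g0 g0E}dE : fd_set d = range (fun x => val (app f x)).
  by rewrite dE; apply: eq_imagel => x _; exact: g0E.
have [n [y [w yw]]] := biorthogonal_fdspace separated d.
have yf i : exists x : fd_type M, val (app f x) = y i.
  by have := biorthogonal_basis yw i; rewrite dE => -[x _ xy]; exists x.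
have {yf}[x xy] := cid_fun yf.
pose c : fd_icat V := fd_span (fun i => val (x i)).
pose r v := \sum_(i < n) b (w i) v *: val (x i).
have r_linear : linear r.
  move=> a v v'; rewrite scaler_sumr -big_split; apply: eq_bigr => i _ /=.
  by rewrite linearPr scalerDl scalerA.
have cr v : fd_set c (r v) by exists (fun i => b (w i) v).
have df m : fd_set d (val (app f m)) by rewrite dE; exists m.
have cM v : fd_set c v -> fd_set M v.
  by move=> [a _ <-]; rewrite -fd_val_comb; exact: fd_mem.
have [i iI] := incl_ex cM.
have [j jI] : exists j : @hom (fd_icat V) d N, incl j.
  by apply: incl_ex => v; rewrite dE => -[m _ <-]; exact: fd_mem.
have [|q qE] := @app_ex M c (fun m => r (val (app f m))) _ (fun=> cr _).
  by move=> a m m'; rewrite (linearP (app f)) fd_val_linear r_linear.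
have [|u uE] := @app_ex c d (fun z => val (app f (app i z))) _ (fun=> df _).
  by move=> a z z'; rewrite (linearP (app i)) (linearP (app f)) fd_val_linear.
have [|g gE] := @app_ex d c (fun v => r (val v)) _ (fun=> cr _).
  by move=> a v v'; rewrite fd_val_linear r_linear.
have fir z v : val z = r v -> fd_set d v -> val (app f (app i z)) = v.
  move=> zr /yw.2 ->; have -> : app i z = \sum_(k < n) b (w k) v *: x k.
    by apply: val_inj; rewrite (incl_app _ iI) zr fd_val_comb.
  rewrite (linear_comb (app f)) fd_val_comb.
  by apply: eq_bigr => k _; rewrite xy.
have rfi z : r (val (app f (app i z))) = val z.
  have [a _ az] : fd_set c (val z) := fd_mem z.
  pose v := \sum_(k < n) a k *: y k.
  have zr : val z = r v.
    rewrite -az; apply: eq_bigr => k _.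
    by rewrite (biorthogonal_coord _ _ yw.1).
  rewrite (fir _ v)// yw.2; apply: eq_bigr => k _.
  by rewrite (biorthogonal_coord _ _ yw.1).
exists c, d, q, u, j; split=> //.
- exists i; split=> //; apply: app_ext => z.
  by rewrite app_comp qE rfi app_id.
- exists g; split; apply: app_ext => z; rewrite app_comp app_id.
    by rewrite gE uE rfi.
  by rewrite uE; apply: fir (fd_mem z); exact: gE.
- apply: app_ext => m; rewrite !app_comp (incl_app _ jI) uE.
  by apply/esym/fir => //; exact: qE.
Qed.

Lemma epi_componentE M N (f : hom M N) :
  fd_set (projT1 (epi_component f)) = range (fun x => val (app f x)) /\
  forall x, val (app (projT2 (epi_component f)) x) = val (app f x).
Proof.
rewrite /epi_component; case: pselect => [fe|]; last first.
  case; have [c [d [q [u [j fE]]]]] := fd_normal_factorization f.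
  by exists (existT _ d (q ;; u)), c, d, q, u, j.
by apply: is_epi_component_app; case: cid.
Qed.

Lemma fd_normal : normal_category (fd_icat V).
Proof.
split; [exact: fd_subobjects|exact: fd_normal_factorization| |].
- move=> M N j jI; have [p pK] := fd_projection separated M.
  have [|q qE] := @app_ex N M (fun x => val (p (val x))) _ (fun=> fd_mem _).
    by move=> a x y; rewrite fd_val_linear (linearP p) fd_val_linear.
  exists q; apply: app_ext => x.
  by rewrite app_comp app_id qE (incl_app _ jI) pK.
- move=> M; have [p pK] := fd_projection separated M.
  have gE N : exists g : hom N M, forall x, val (app g x) = val (p (val x)).
    apply: app_ex => [a x y|x]; last exact: fd_mem.
    by rewrite fd_val_linear (linearP p) fd_val_linear.
  have [g {}gE] := cid_fun gE.
  have g1 : g M = idm M by apply: app_ext => x; rewrite gE pK.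
  exists g; split=> //.
  + move=> N' N j jI; apply: app_ext => x.
    by rewrite app_comp !gE (incl_app _ jI).
  + by exists M; rewrite g1; exists (idm M); rewrite comp1m.
Qed.

End FdCategory.

(** * Cones as finite-rank linear maps *)

Section Cones.
Variables (K : fieldType) (V : lmodType K).
Notation FV := (fd_icat V).
Implicit Types g e : cone FV.

Definition line (x : V) : FV := fd_span (fun _ : 'I_1 => x).

Lemma line_mem x : fd_set (line x) x.
Proof. by exists (fun=> 1) => //; rewrite big_ord1 scale1r. Qed.

Definition line_pt x : fd_type (line x) :=
  FdType (mem_set (line_mem x) : x \in fd_pred (line x)).

(** The space [V] is the directed union of its finite-dimensional subspaces,
    so that the components of a cone glue to one map on [V]. *)
Definition total g (x : V) : V := val (app (g (line x)) (line_pt x)).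

Lemma total_val g (M : FV) (x : fd_type M) :
  val (app (g M) x) = total g (val x).
Proof.
have [j jI] : exists j : hom (line (val x)) M, incl j.
  apply: incl_ex => _ [c _ <-]; rewrite big_ord1 -[_ *: _]addr0.
  apply: fd_linear_comb (fd_mem x) _.
  by rewrite -[X in fd_set _ X](raddf0 (val : {linear fd_type M -> V}));
     exact: fd_mem.
rewrite /total (coneP g jI) app_comp; congr (val (app _ _)).
by apply: val_inj; rewrite (incl_app _ jI).
Qed.

Lemma total_mem g x : fd_set (vertex g) (total g x).
Proof. exact: fd_mem. Qed.

Lemma total_linear g : linear (total g).
Proof.
move=> a x y; pose s i := [tuple x; y]`_i.
have [u ux] : exists u : fd_type (fd_span (fun i : 'I_2 => s i)), val u = x.
  apply: fd_mk; exists (fun i => (i == ord0)%:R) => //.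
  by rewrite !big_ord_recl big_ord0 /= scale1r scale0r !addr0.
have [v vy] : exists v : fd_type (fd_span (fun i : 'I_2 => s i)), val v = y.
  apply: fd_mk; exists (fun i => (i != ord0)%:R) => //.
  by rewrite !big_ord_recl big_ord0 /= scale1r scale0r addr0 add0r.
rewrite -ux -vy -fd_val_linear -!total_val.
by rewrite (linearP (app (g (fd_span _ : FV)))) fd_val_linear.
Qed.

Lemma cone_of_linear (d : FV) (L : V -> V) : linear L ->
  (forall x, fd_set d (L x)) ->
  exists g, vertex g = d /\ forall x, total g x = L x.
Proof.
move=> Ll Ld.
have hE (M : FV) : exists f : hom M d, forall x, val (app f x) = L (val x).
  by apply: app_ex => // a x y; rewrite fd_val_linear Ll.
have [h {}hE] := cid_fun hE.
have hC : is_cone h.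
  move=> M N j jI; apply: app_ext => x.
  by rewrite app_comp !hE (incl_app _ jI).
by exists (Cone hC); split=> // x; rewrite /total hE.
Qed.

Definition onto g := forall v, fd_set (vertex g) v -> exists x, total g x = v.

Lemma normal_cone_onto g : is_normal_cone g -> onto g.
Proof.
move=> [M gM] v /fd_mk[y <-]; have [x <-] := iso_surj gM y.
by exists (val x); rewrite total_val.
Qed.

(** The vertex of an onto cone is the range of its total map. *)
Lemma cone_ext g g' : onto g -> onto g' -> total g =1 total g' -> g = g'.
Proof.
move=> go go' gg'.
have vv : vertex g = vertex g'.
  apply/fdspace_eq/seteqP; split=> [v /go[x <-]|v /go'[x <-]].
    by rewrite gg'; exact: total_mem.
  by rewrite -gg'; exact: total_mem.
have {}gg' M (x : fd_type M) : val (app (g M) x) = val (app (g' M) x).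
  by rewrite !total_val gg'.
move: g g' vv gg' {go go'} => [d h hC] [d' h' hC'] /= vv gg'.
case: _ / vv in h' hC' gg' *.
have hh : h = h'.
  by apply: functional_extensionality_dep => M; apply: app_ext; exact: gg'.
by case: _ / hh in hC' gg' *; congr Cone; exact: Prop_irrelevance.
Qed.

Variables (W : lmodType K) (b : {bilinear W -> V -> K | *%R & *%R}).
Hypothesis separated : forall x, (forall w, b w x = 0) -> x = 0.

Section StarEpi.
Variables (g : cone FV) (c : FV) (f : hom (vertex g) c).

Lemma total_star_epi x (z : fd_type (vertex g)) :
  val z = total g x -> total (star_epi f) x = val (app f z).
Proof.
have [_ fE] := epi_componentE separated f.
move=> zx; rewrite /total [LHS]fE; congr (val (app f _)).
exact/val_inj/esym.
Qed.

Lemma star_epi_onto : onto g -> onto (star_epi f).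
Proof.
have [rE _] := epi_componentE separated f.
move=> go v; rewrite [fd_set _]rE => -[z _ <-].
have [x xz] := go _ (fd_mem z).
by exists x; apply: total_star_epi.
Qed.

Lemma total_star_epi_mem x : fd_set c (total (star_epi f) x).
Proof.
have [z zE] := fd_mk (total_mem g x).
by rewrite (total_star_epi zE); exact: fd_mem.
Qed.

End StarEpi.

Lemma star_epi_inj g (c : FV) (f f' : hom (vertex g) c) : onto g ->
  star_epi f = star_epi f' -> f = f'.
Proof.
move=> go ff; apply: app_ext => z; have [x xz] := go _ (fd_mem z).
by rewrite -!(total_star_epi _ (esym xz)) ff.
Qed.

Lemma star_epiP g e (c : FV) (f : hom (vertex e) c) : onto e -> onto g ->
  (forall x (z : fd_type (vertex e)), val z = total e x ->
     total g x = val (app f z)) -> star_epi f = g.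
Proof.
move=> eo go gf; apply: cone_ext => //; first exact: star_epi_onto.
move=> x; have [z zE] := fd_mk (total_mem e x).
by rewrite (total_star_epi f zE) (gf x z zE).
Qed.

Lemma idempotent_cone e : onto e ->
  cone_mul e e = e <-> forall x, total e (total e x) = total e x.
Proof.
move=> eo; split=> [ee x|ee].
  have [z zE] := fd_mk (total_mem e x).
  by rewrite -[in RHS]ee (total_star_epi _ zE) total_val zE.
by apply: star_epiP => // x z zE; rewrite total_val zE ee.
Qed.

(** * The functors H(e, -) *)

Lemma set_mk (T : Type) (A : set T) v : A v -> exists x : A, val x = v.
Proof. by move=> Av; exists (exist _ v (mem_set Av)). Qed.

Lemma set_val (T : Type) (A : set T) (x : A) : A (val x).
Proof. by case: x => x /= /set_mem. Qed.

(** As [e] is onto, [f] is determined by the cone e * f, so that the action of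
    [k], which is described through [f], is well defined. *)
Lemma H_functor_ex e : onto e -> exists F, is_H_functor e F.
Proof.
move=> eo; pose H c := [set star_epi f | f in [set: hom (vertex e) c]].
have kE (u : {p : FV * FV & (hom p.1 p.2 * H p.1)%type}) :
    exists y : H (projT1 u).2,
      forall f : hom (vertex e) (projT1 u).1, val (projT2 u).2 = star_epi f ->
      val y = star_epi (f ;; (projT2 u).1).
  case: u => -[c c'] /= [k x]; have [f _ fx] := set_val x.
  have [y yE] : exists y : H c', val y = star_epi (f ;; k).
    by apply: set_mk; exists (f ;; k).
  by exists y => f'; rewrite -fx => ff'; rewrite -(star_epi_inj eo ff').
have [m mE] := cid_fun kE.
pose Hm c c' (k : hom c c') (x : H c) : H c' :=
  m (existT (fun p : FV * FV => (hom p.1 p.2 * H p.1)%type) (c, c') (k, x)).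
have HmE c c' (k : hom c c') (x : H c) (f : hom (vertex e) c) :
    val x = star_epi f ->
    val (Hm c c' k x) = star_epi (f ;; k).
  exact: mE (existT (fun p : FV * FV => (hom p.1 p.2 * H p.1)%type) (c, c')
    (k, x)) f.
have Hm1 c : Hm c c (idm c) = @idm (set_cat (cone FV)) (H c).
  apply/funext => x; apply: val_inj; have [f _ fx] := set_val x.
  by rewrite (HmE _ _ _ _ f)// compm1.
have HmM (c c' c'' : FV) (k : hom c c') (l : hom c' c'') :
    Hm c c'' (k ;; l) = comp (Hm c c' k : @hom (set_cat (cone FV)) (H c) (H c'))
     (Hm c' c'' l).
  apply/funext => x; apply: val_inj; have [f _ fx] := set_val x.
  rewrite (HmE _ _ _ _ f)// compmA.
  by apply/esym; apply: (HmE _ _ l (Hm c c' k x)); exact: HmE.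
exists (@Functor FV (set_cat (cone FV)) H Hm Hm1 HmM).
by split=> // c c' k f x; exact: HmE.
Qed.

(** Functors to sets are compared through underlying elements, because their
    values are only propositionally equal. *)
Lemma set_functor_ext (C : category) (T : Type) (F G : functor C (set_cat T)) :
  (forall c, F c = G c) ->
  (forall c c' (k : hom c c') (x : @set_type T (F c)) (y : @set_type T (G c)),
     val x = val y ->
     val (fmap F k x) = val (fmap G k y)) -> F = G.
Proof.
move=> /funext FG FGm; apply: functor_ext => a c k.
case: F G => [F Fm F1 FM] [G Gm G1 GM] /= in FG FGm *.
case: _ / FG in Gm G1 GM FGm *; congr arr.
by apply/funext => x; apply: val_inj; exact: FGm.
Qed.

Lemma H_functor_onto e (F : functor FV (set_cat (cone FV))) (c : FV)
    (x : @set_type (cone FV) (F c)) :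
  onto e -> is_H_functor e F -> onto (val x).
Proof.
move=> eo [FE _].
have [f _ <-] : [set star_epi f | f in [set: hom (vertex e) c]] (val x)
    by rewrite -FE; exact: set_val.
exact: star_epi_onto.
Qed.

Lemma H_functor_map e (F : functor FV (set_cat (cone FV))) (c c' : FV)
    (k : hom c c') (x : @set_type (cone FV) (F c)) y (z : fd_type c) :
  is_H_functor e F -> val z = total (val x) y ->
  total (val (fmap F k x)) y = val (app k z).
Proof.
move=> [FE FmE] zE.
have [f _ fx] : [set star_epi f | f in [set: hom (vertex e) c]] (val x)
    by rewrite -FE; exact: set_val.
have [t tE] := fd_mk (total_mem e y).
rewrite (FmE _ _ _ f _ (esym fx)) (total_star_epi _ tE) app_comp.
congr (val (app k _)); apply: val_inj.
by rewrite zE -fx (total_star_epi _ tE).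
Qed.

(** A cone belongs to the c-component of H(e, -) when its total map has values
    in [c] and factors through that of [e]. *)
Lemma H_functor_mem e (F : functor FV (set_cat (cone FV))) (c : FV) g :
  onto e -> (forall x, total e (total e x) = total e x) ->
  is_H_functor e F ->
  F c g <-> [/\ onto g, (forall x, fd_set c (total g x)) &
                forall x, total g (total e x) = total g x].
Proof.
move=> eo ee [FE _]; rewrite FE; split=> [[f _ <-]|[go gc ge]].
  split=> [|x|x]; first exact: star_epi_onto.
    exact: total_star_epi_mem.
  have [z zE] := fd_mk (total_mem e x).
  by rewrite (total_star_epi _ zE); apply: total_star_epi; rewrite ee.
have [|f fE] := @app_ex _ _ (vertex e) c (fun z => total g (val z)) _
  (fun=> gc _).
  by move=> a z z'; rewrite fd_val_linear total_linear.
by exists f => //; apply: star_epiP => // x z zE; rewrite fE zE ge.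
Qed.

End Cones.

(** * Continuous functionals *)

Section Dual.
Variables (K : numFieldType) (V : normedModType K).
Implicit Types phi psi : dual V.

Lemma dual_ext phi psi : phi =1 psi -> phi = psi.
Proof. by move=> pp; apply: val_inj; exact/funext. Qed.

Lemma dual_linearP phi (a : K) x y : phi (a *: x + y) = a * phi x + phi y.
Proof.
by have /asboolP[fl _] : dual_fun phi \in @dual_pred K V := valP phi; exact: fl.
Qed.

Lemma dualE (a : K) phi psi x : (a *: phi + psi) x = a * phi x + psi x.
Proof.
by have := congr1 (fun f : V -> K^o => f x)
  (linearP (val : {linear dual V -> (V -> K^o)}) a phi psi).
Qed.

Definition dual_eval phi x : K := phi x.
Definition eval_dual x phi : K := phi x.

Lemma dual_eval_bilinear :
  bilinear_for ( *%R : GRing.Scale.law K K^o) ( *%R : GRing.Scale.law K K^o)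
    dual_eval.
Proof.
by split=> [x a phi psi|phi a x y]; [exact: dualE|exact: dual_linearP].
Qed.

Lemma eval_dual_bilinear :
  bilinear_for ( *%R : GRing.Scale.law K K^o) ( *%R : GRing.Scale.law K K^o)
    eval_dual.
Proof.
by split=> [phi a x y|x a phi psi]; [exact: dual_linearP|exact: dualE].
Qed.

HB.instance Definition _ :=
  bilinear_isBilinear.Build K (dual V) V K *%R *%R dual_eval dual_eval_bilinear.
HB.instance Definition _ :=
  bilinear_isBilinear.Build K V (dual V) K *%R *%R eval_dual eval_dual_bilinear.

Lemma eval_dual_separated phi : (forall x, eval_dual x phi = 0) -> phi = 0.
Proof.
move=> phi0; apply: dual_ext => x.
by rewrite [LHS]phi0 -[RHS]/(dual_eval 0 x) linear0l.
Qed.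

Lemma dual_comb n (c : 'I_n -> K) (w : 'I_n -> dual V) x :
  (\sum_(i < n) c i *: w i : dual V) x = \sum_(i < n) c i * w i x.
Proof. exact: (comb_pairing dual_eval). Qed.

Lemma dual_sum phi n (c : 'I_n -> K) (x : 'I_n -> V) :
  phi (\sum_(i < n) c i *: x i) = \sum_(i < n) c i * phi (x i).
Proof. exact: (pairing_comb dual_eval). Qed.

Lemma dual_bound phi :
  exists2 a : K, 0 <= a & forall x, `|phi x : K| <= a * `|x|.
Proof.
have /asboolP[fl fc] : dual_fun phi \in @dual_pred K V := valP phi.
have [f fE] := linear_pack fl.
have /linear_bounded_continuous/linear_boundedP/pinfty_ex_gt0[a a0 fa] :
  continuous f by rewrite (_ : (f : V -> K^o) = phi)//; exact/funext.
by exists a; [exact: ltW|move=> x; rewrite -fE; exact: fa].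
Qed.

Lemma dual_ex (f : V -> K^o) (a : K) : a \is Num.real -> linear f ->
  (forall x, `|f x : K| <= a * `|x|) -> exists phi, phi =1 f.
Proof.
move=> aR fl fa; suff fD : f \in @dual_pred K V by exists (Dual fD).
apply/asboolP; split=> //; have [g gf] := linear_pack fl.
have -> : f = g by apply/funext => x; rewrite gf.
apply/linear_bounded_continuous/linear_boundedP.
exists a; split=> // r ar x; rewrite gf (le_trans (fa x))//.
by rewrite ler_wpM2r// ltW.
Qed.

(** The bound on unit vectors extends to all vectors by rescaling. *)
Lemma bounded_total (g : cone (fd_icat V)) : bounded_cone g ->
  exists2 a : K, 0 <= a & forall x, `|total g x| <= a * `|x|.
Proof.
move=> [a aR ga].
have ga1 x : `|x| <= 1 -> `|total g x| <= a.
  by move=> x1; exact: (ga (line x) (line_pt x)).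
have total0 : total g 0 = 0.
  have [t tE] := linear_pack (total_linear g).
  by rewrite -tE linear0.
have a0 : 0 <= a by have := ga1 0; rewrite total0 !normr0 ler01; exact.
exists a => // x; have [->|xN0] := eqVneq x 0.
  by rewrite total0 !normr0 mulr0.
have [t tE] := linear_pack (total_linear g).
have := ga1 (`|x|^-1 *: x); rewrite -tE linearZ !normrZ normfV normr_id.
rewrite mulVf ?normr_eq0// lexx => /(_ isT).
by rewrite tE mulrC ler_pdivrMr ?normr_gt0.
Qed.

Lemma dual_comp phi (g : cone (fd_icat V)) : bounded_cone g ->
  exists psi, forall x, psi x = phi (total g x).
Proof.
move=> /bounded_total[a a0 ga]; have [c c0 phic] := dual_bound phi.
have [||x|psi psiE] := @dual_ex (fun x => phi (total g x)) (c * a).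
- by rewrite ger0_real// mulr_ge0.
- by move=> z x y; rewrite total_linear dual_linearP.
- by rewrite (le_trans (phic _))// -mulrA ler_wpM2l.
- by exists psi.
Qed.

End Dual.

(** * The bounded normal dual *)

Section BoundedDual.
Variables (K : numFieldType) (V : normedModType K).
Hypothesis separated : forall x : V, (forall phi : dual V, phi x = 0) -> x = 0.

Notation FV := (fd_icat V).
Notation B := (bounded_dual V).
Notation FD := (fd_icat (dual V)).
Notation b := (@dual_eval K V : {bilinear _ -> _ -> _ | *%R & *%R}).
Notation b' := (@eval_dual K V : {bilinear _ -> _ -> _ | *%R & *%R}).
Notation elt F c := (@set_type (cone FV) (sval F c)).

Let sep : forall x, (forall w, b w x = 0) -> x = 0 := separated.
Let sep' : forall phi, (forall x, b' x phi = 0) -> phi = 0 :=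
  @eval_dual_separated K V.

Lemma eq_of_dual (x y : V) : (forall phi : dual V, phi x = phi y) -> x = y.
Proof.
move=> xy; apply/eqP; rewrite -subr_eq0; apply/eqP/separated => phi.
have := dual_linearP phi (-1) y x.
by rewrite scaleN1r mulN1r xy addNr addrC.
Qed.

Lemma bounded_dual_gen (F : B) : exists e : cone FV,
  [/\ onto e, bounded_cone e, (forall x, total e (total e x) = total e x) &
      is_H_functor e (sval F)].
Proof.
have [e [/normal_cone_onto eo eb ee HF]] := svalP F; exists e; split=> //.
exact/(idempotent_cone sep).
Qed.

Lemma bounded_dual_onto (F : B) (c : FV) (g : elt F c) : onto (val g).
Proof.
have [e [eo _ _ HF]] := bounded_dual_gen F; exact (H_functor_onto sep eo HF).
Qed.

Lemma bounded_dual_map (F : B) (c c' : FV) (k : hom c c') (g : elt F c) x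
    (z : fd_type c) : val z = total (val g) x ->
  total (val (fmap (sval F) k g)) x = val (app k z).
Proof.
move=> zE; have [e [_ _ _ HF]] := bounded_dual_gen F.
exact (H_functor_map sep k HF zE).
Qed.

(** For F = H(e, -) with [e] a projection, these are the functionals vanishing
    on the kernel of [e]. *)
Definition coords (F : B) : set (dual V) :=
  [set phi | exists (c : FV) (g : cone FV) (psi : dual V),
     sval F c g /\ forall x, phi x = psi (total g x)].

Lemma coordsE (F : B) e :
  onto e -> (forall x, total e (total e x) = total e x) ->
  is_H_functor e (sval F) ->
  forall phi, coords F phi <-> forall x, phi (total e x) = phi x.
Proof.
move=> eo ee HF phi; have memF c g := H_functor_mem sep c g eo ee HF.
split=> [[c [g [psi [/memF[_ _ ge] phiE]]]] x|phie].
  by rewrite !phiE ge.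
exists (vertex e), e, phi; split=> //.
by apply/memF; split=> // x; exact: total_mem.
Qed.

(** The functional psi L is continuous: it factors through the bounded [e],
    and on the range of [e] it is a combination of the continuous functionals
    dual to a basis of this range. *)
Lemma factor_coords (F : B) e (L : V -> V) (psi : dual V) :
  onto e -> bounded_cone e -> (forall x, total e (total e x) = total e x) ->
  is_H_functor e (sval F) -> linear L -> (forall x, L (total e x) = L x) ->
  exists2 phi, coords F phi & forall x, phi x = psi (L x).
Proof.
move=> eo eb ee HF Ll Le.
have [n [v [w vw]]] := biorthogonal_fdspace sep (vertex e).
have [we weE] := cid_fun (fun i => dual_comp (w i) eb).
have [l lE] := linear_pack Ll.
exists (\sum_(i < n) psi (L (v i)) *: we i).
  apply/(coordsE eo ee HF) => x; rewrite !dual_comb.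
  by apply: eq_bigr => i _; rewrite !weE ee.
move=> x; rewrite dual_comb -[in RHS]Le (vw.2 (total e x)).1; last first.
  exact: total_mem.
rewrite -lE linear_comb dual_sum; apply: eq_bigr => i _.
by rewrite lE weE mulrC.
Qed.

(** Membership depends on [F] only through [coords F]: as V' separates points,
    [g] factors through the projection defining [F] as soon as its coordinates
    do. *)
Lemma bounded_dual_mem (F : B) (c : FV) (g : cone FV) : sval F c g <->
  [/\ onto g, (forall x, fd_set c (total g x)) &
      forall psi : dual V, exists2 phi, coords F phi &
        forall x, phi x = psi (total g x)].
Proof.
have [e [eo eb ee HF]] := bounded_dual_gen F.
rewrite (H_functor_mem sep c g eo ee HF).
split=> -[go gc gP]; split=> //.
  by move=> psi; exact: factor_coords (total_linear g) gP.
move=> x; apply: eq_of_dual => psi.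
have [phi /(coordsE eo ee HF) phie phiE] := gP psi.
by rewrite -!phiE.
Qed.

Lemma bounded_dual_mem_ex (F : B) (c : FV) (L : V -> V) : linear L ->
  (forall x, fd_set c (L x)) ->
  (forall psi : dual V, exists2 phi, coords F phi &
    forall x, phi x = psi (L x)) ->
  exists g : elt F c, forall x, total (val g) x = L x.
Proof.
move=> Ll Lc LP; have [e [eo eb ee HF]] := bounded_dual_gen F.
have Le x : L (total e x) = L x.
  apply: eq_of_dual => psi.
  have [phi /(coordsE eo ee HF) phie phiE] := LP psi.
  by rewrite -!phiE.
have [|f fE] := @app_ex _ _ (vertex e) c (fun z => L (val z)) _
  (fun=> Lc _).
  by move=> a z z'; rewrite fd_val_linear Ll.
have sE x : total (star_epi f) x = L x.
  have [z zE] := fd_mk (total_mem e x).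
  by rewrite (total_star_epi sep f zE) fE zE Le.
have [g gE] : exists g : elt F c, val g = star_epi f.
  apply: set_mk; apply/bounded_dual_mem; split=> [|x|psi].
  - exact (star_epi_onto sep eo).
  - by rewrite sE.
  - by have [phi phiF phiE] := LP psi; exists phi => // x; rewrite sE.
by exists g => x; rewrite gE sE.
Qed.

Lemma coords_fd (F : B) : exists N : FD, fd_set N = coords F.
Proof.
have [e [eo eb ee HF]] := bounded_dual_gen F.
have [n [v [w vw]]] := biorthogonal_fdspace sep (vertex e).
have [we weE] := cid_fun (fun i => dual_comp (w i) eb).
exists (fd_span we); apply/seteqP; split=> [_ [c _ <-]|phi].
  apply/(coordsE eo ee HF) => x; rewrite !dual_comb.
  by apply: eq_bigr => i _; rewrite !weE ee.
move=> /(coordsE eo ee HF) phie; exists (fun i => phi (v i)) => //.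
apply: dual_ext => x; rewrite dual_comb -[RHS]phie.
rewrite [X in _ = phi X](vw.2 (total e x)).1; last exact: total_mem.
by rewrite dual_sum; apply: eq_bigr => i _; rewrite weE mulrC.
Qed.

Definition coord_space (F : B) : FD := projT1 (cid (coords_fd F)).

Lemma coord_spaceE (F : B) : fd_set (coord_space F) = coords F.
Proof. by rewrite /coord_space; case: cid. Qed.

Lemma coord_space_inj : injective coord_space.
Proof.
move=> F F' FF'.
have {}FF' : coords F = coords F' by rewrite -!coord_spaceE FF'.
have sFF' : sval F = sval F'.
  have FcE c : sval F c = sval F' c.
    apply/seteqP; split=> g /bounded_dual_mem gP; apply/bounded_dual_mem.
      by rewrite -FF'.
    by rewrite FF'.
  apply: set_functor_ext => // c c' k g g' gg'.
  apply: cone_ext; [exact: bounded_dual_onto|exact: bounded_dual_onto|].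
  move=> x; have [z zE] : exists z : fd_type c, val z = total (val g) x.
    by have /bounded_dual_mem[_ gc _] := set_val g; exact: fd_mk.
  by rewrite (bounded_dual_map k zE) (@bounded_dual_map _ _ _ k g' _ z)// -gg'.
case: F F' sFF' {FF'} => [F FP] [F' F'P] /= FF'; case: _ / FF' in F'P *.
by congr exist; exact: Prop_irrelevance.
Qed.

(** With [phi] a basis of [N] and [x] a dual family of vectors, [L] is the
    bounded projection onto the span of [x] whose kernel is the common kernel
    of the functionals in [N]. *)
Lemma coord_space_surj (N : FD) : exists F, coord_space F = N.
Proof.
have [n [phi [x xphi]]] := biorthogonal_fdspace sep' N.
have phix i j : phi i (x j) = (i == j)%:R by rewrite eq_sym -(xphi.1 j i).
pose L y := \sum_(i < n) phi i y *: x i.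
have Ll : linear L.
  move=> a y z; rewrite scaler_sumr -big_split; apply: eq_bigr => i _ /=.
  by rewrite dual_linearP scalerDl scalerA.
have phiL i y : phi i (L y) = phi i y.
  rewrite dual_sum -[RHS](@sum_delta _ K^o _ (fun j => phi j y)).
  by apply: eq_bigr => j _; rewrite phix mulrC.
have LL y : L (L y) = L y by apply: eq_bigr => i _; rewrite phiL.
have [e [ed eL]] := cone_of_linear Ll
  (fun y => (ex_intro2 _ _ (fun i => phi i y) I erefl :
    fd_set (fd_span x) (L y))).
have Lv v : fd_set (vertex e) v -> L v = v.
  rewrite ed => -[c _ <-]; apply: eq_bigr => i _; congr (_ *: _).
  rewrite dual_sum -[RHS](@sum_delta _ K^o).
  by apply: eq_bigr => j _; rewrite phix mulrC.
have eo : onto e by move=> v /Lv vL; exists v; rewrite eL.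
have ee y : total e (total e y) = total e y by rewrite !eL.
have eb : bounded_cone e.
  have [a a0 aP] : exists2 a : 'I_n -> K, (forall i, 0 <= a i) &
      forall i y, `|phi i y : K| <= a i * `|y|.
    have [a aP] := cid_fun (fun i =>
      let: ex_intro2 a a0 aP := dual_bound (phi i) in
      ex_intro (fun a => 0 <= a /\ forall y, `|phi i y : K| <= a * `|y|) a
        (conj a0 aP)).
    by exists a => i; have [] := aP i.
  exists (\sum_(i < n) a i * `|x i|).
    by apply: ger0_real; apply: sumr_ge0 => i _; rewrite mulr_ge0.
  move=> M y y1; rewrite total_val eL (le_trans (ler_norm_sum _ _ _))//.
  apply: ler_sum => i _; rewrite normrZ ler_wpM2r//.
  by rewrite (le_trans (aP _ _))// ler_piMr.
have [F HF] := H_functor_ex sep eo.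
have FB : is_bounded_dual_ob F.
  exists e; split=> //; last exact/(idempotent_cone sep).
  exists (vertex e), (idm _).
  suff -> : e (vertex e) = idm _ by rewrite comp1m.
  by apply: app_ext => z; rewrite total_val eL Lv//; exact: fd_mem.
have FE := @coordsE (exist _ F FB : B) e eo ee HF.
exists (exist _ F FB); apply/fdspace_eq/seteqP; split=> f; rewrite coord_spaceE.
  move=> /FE fe; apply/xphi.2/dual_ext => y.
  rewrite -fe eL dual_sum dual_comb; apply: eq_bigr => i _.
  by rewrite mulrC.
move=> /xphi.2 fE; apply/FE => y.
by rewrite eL fE !dual_comb; apply: eq_bigr => i _; rewrite phiL.
Qed.

(** The coordinates of the image of a cone [g] under [s] are the images under
    [t] of the coordinates of [g]. When [s] is precomposition by an operator of
    V, [t] is the restriction of the transpose of this operator. *)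
Definition transposes (F F' : B) (s : hom F F')
    (t : hom (coord_space F) (coord_space F')) :=
  forall (c : FV) (g : elt F c) (psi : dual V) (phi : fd_type (coord_space F)),
    (forall x, val phi x = psi (total (val g) x)) ->
    forall x, val (app t phi) x = psi (total (val (s c g : elt F' c)) x).

Lemma transposes_coord (F : B) (phi : fd_type (coord_space F)) :
  exists (c : FV) (g : elt F c) (psi : dual V),
    forall x, val phi x = psi (total (val g) x).
Proof.
have := fd_mem phi; rewrite coord_spaceE => -[c [g [psi [Fg phiE]]]].
by have [g' g'E] := set_mk Fg; exists c, g', psi; rewrite g'E.
Qed.

Lemma coord_of (F : B) (c : FV) (g : elt F c) (psi : dual V) :
  exists phi : fd_type (coord_space F),
    forall x, val phi x = psi (total (val g) x).
Proof.
have /bounded_dual_mem[_ _ /(_ psi)[phi phiF phiE]] := set_val g.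
rewrite -coord_spaceE in phiF; have [f fE] := fd_mk phiF.
by exists f; rewrite fE.
Qed.

Lemma elt_ext (F F' : B) (c : FV) (g : elt F c) (g' : elt F' c) :
  (forall (psi : dual V) x, psi (total (val g) x) = psi (total (val g') x)) ->
  val g = val g'.
Proof.
move=> gg'; apply: cone_ext; try exact: bounded_dual_onto.
by move=> x; apply: eq_of_dual => psi; exact: gg'.
Qed.

(** The Yoneda lemma: [e] itself generates H(e, -), so a transformation is
    determined by the image of [e]; it precomposes every cone with the total
    map [T] of that image. *)
Lemma transformation_precomp (F F' : B) (s : hom F F') :
  exists T : V -> V, forall (c : FV) (g : elt F c) x,
    total (val (s c g : elt F' c)) x = total (val g) (T x).
Proof.
have [e [eo eb ee HF]] := bounded_dual_gen F.
have memF c g := H_functor_mem sep c g eo ee HF.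
have [e0 e0E] : exists e0 : elt F (vertex e), val e0 = e.
  by apply/set_mk/memF; split=> // x; exact: total_mem.
exists (total (val (s _ e0 : elt F' (vertex e)))) => c g x.
have /memF[_ gc ge] := set_val g.
have [|f fE] := @app_ex _ _ (vertex e) c (fun z => total (val g) (val z)) _
  (fun=> gc _).
  by move=> a z z'; rewrite fd_val_linear total_linear.
have gE : g = fmap (sval F) f e0.
  apply: val_inj; apply: cone_ext; try exact: bounded_dual_onto.
  move=> y.
  have [z zE] : exists z : fd_type (vertex e), val z = total (val e0) y.
    by apply: fd_mk; rewrite e0E; exact: total_mem.
  by rewrite (bounded_dual_map f zE) fE zE e0E ge.
have [z zE] : exists z : fd_type (vertex e),
    val z = total (val (s _ e0 : elt F' (vertex e))) x.
  apply: fd_mk.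
  by have /bounded_dual_mem[] := set_val (s _ e0 : elt F' (vertex e)).
have sN : s c (fmap (sval F) f e0) = fmap (sval F') f (s _ e0).
  exact: (congr1 (fun h => h e0) (natural s f)).
by rewrite {1}gE sN (bounded_dual_map f zE) fE zE.
Qed.

Lemma transposes_total (F F' : B) (s : hom F F') : exists t, transposes s t.
Proof.
have [T sT] := transformation_precomp s.
have TE (phi : fd_type (coord_space F)) :
    exists phi' : fd_type (coord_space F'),
      forall x, val phi' x = val phi (T x).
  have [c [g [psi phiE]]] := transposes_coord phi.
  have [phi' phi'E] := coord_of (s c g : elt F' c) psi.
  by exists phi' => x; rewrite phi'E phiE sT.
have [t tE] := cid_fun TE.
have [||t' t'E] := @app_ex _ _ (coord_space F) (coord_space F')
  (fun phi => val (t phi)).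
- move=> a phi phi'; apply: dual_ext => x.
  by rewrite dualE !tE fd_val_linear dualE.
- by move=> phi; exact: fd_mem.
by exists t' => c g psi phi phiE x; rewrite t'E tE phiE sT.
Qed.

Lemma transposes_fun (F F' : B) (s : hom F F') t t' :
  transposes s t -> transposes s t' -> t = t'.
Proof.
move=> st st'; apply: app_ext => phi; apply: dual_ext => x.
have [c [g [psi phiE]]] := transposes_coord phi.
by rewrite (st c g psi)// (st' c g psi).
Qed.

Lemma transposes_inj (F F' : B) (s s' : hom F F') t :
  transposes s t -> transposes s' t -> s = s'.
Proof.
move=> st s't; apply: nat_transP => c; apply/funext => g; apply: val_inj.
apply: elt_ext => psi x; have [phi phiE] := coord_of g psi.
by rewrite -(st c g psi phi)// -(s't c g psi phi).
Qed.

(** With [v] a basis of the range of [e] and [w] dual functionals, the w_i e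
    form a basis of the coordinate space dual to [v]; thus [t] is precomposition
    by the operator sending x to the sum of the t(w_i e)(x) v_i. *)
Lemma coord_map_precomp (F F' : B) (t : hom (coord_space F) (coord_space F')) :
  exists T : V -> V, linear T /\
    forall (phi : fd_type (coord_space F)) x, val (app t phi) x = val phi (T x).
Proof.
have [e [eo eb ee HF]] := bounded_dual_gen F.
have [n [v [w vw]]] := biorthogonal_fdspace sep (vertex e).
have weE i : exists phi : fd_type (coord_space F),
    forall x, val phi x = w i (total e x).
  have [we weE] := dual_comp (w i) eb.
  have [|phi phiE] := @fd_mk _ _ (coord_space F) we.
    by rewrite coord_spaceE; apply/(coordsE eo ee HF) => x; rewrite !weE ee.
  by exists phi; rewrite phiE.
have {weE}[we weE] := cid_fun weE.
exists (fun x => \sum_(i < n) val (app t (we i)) x *: v i); split.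
  move=> a x y; rewrite scaler_sumr -big_split; apply: eq_bigr => i _ /=.
  by rewrite dual_linearP scalerDl scalerA.
move=> phi x; have phiwe : phi = \sum_(i < n) val phi (v i) *: we i.
  have := fd_mem phi; rewrite coord_spaceE => /(coordsE eo ee HF) phie.
  apply: val_inj; apply: dual_ext => y; rewrite fd_val_comb dual_comb -phie.
  rewrite [in LHS](vw.2 (total e y)).1; last exact: total_mem.
  by rewrite dual_sum; apply: eq_bigr => i _; rewrite weE mulrC.
rewrite [in LHS]phiwe (linear_comb (app t)) fd_val_comb dual_comb dual_sum.
by apply: eq_bigr => i _; rewrite mulrC.
Qed.

Lemma transposes_surj (F F' : B) (t : hom (coord_space F) (coord_space F')) :
  exists s : hom F F', transposes s t.
Proof.
have [T [Tl tT]] := coord_map_precomp t.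
have sE (u : {c : FV & elt F c}) : exists g : elt F' (projT1 u),
    forall x, total (val g) x = total (val (projT2 u)) (T x).
  case: u => c g /=; apply: bounded_dual_mem_ex => [a x y|x|psi].
  - by rewrite Tl total_linear.
  - by have /bounded_dual_mem[] := set_val g.
  - have [phi phiE] := coord_of g psi; exists (val (app t phi)).
      by rewrite -coord_spaceE; exact: fd_mem.
    by move=> x; rewrite tT phiE.
have [m mE] := cid_fun sE.
pose s (c : FV) (g : elt F c) : elt F' c := m (existT (fun c => elt F c) c g).
have {}sE c g x : total (val (s c g)) x = total (val g) (T x).
  exact: mE (existT (fun c => elt F c) c g) x.
have sN (c c' : FV) (k : hom c c') :
    @comp (set_cat (cone FV)) _ _ _ (fmap (sval F) k) (s c') =
    @comp (set_cat (cone FV)) _ _ _ (s c) (fmap (sval F') k).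
  apply/funext => g; apply: val_inj.
  apply: cone_ext; try exact: bounded_dual_onto.
  move=> x; rewrite /= sE.
  have [z zE] : exists z : fd_type c, val z = total (val g) (T x).
    by have /bounded_dual_mem[_ gc _] := set_val g; exact: fd_mk.
  by rewrite (bounded_dual_map k zE) (@bounded_dual_map _ _ _ k _ _ z)// sE.
exists (@NatTrans FV (set_cat (cone FV)) (sval F) (sval F') s sN).
by move=> c g psi phi phiE x; rewrite tT phiE -sE.
Qed.

(** Both inclusions mean that [g] and its image have the same coordinates. *)
Lemma transposes_incl (F F' : B) (s : hom F F') t :
  transposes s t -> incl t <-> incl s.
Proof.
move=> st; split=> [tI c g|sI phi].
  apply: elt_ext => psi x; have [phi phiE] := coord_of g psi.
  by rewrite -(st c g psi phi)// (incl_app _ tI).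
apply: dual_ext => x; have [c [g [psi phiE]]] := transposes_coord phi.
by rewrite phiE [LHS](st c g psi)// sI.
Qed.

Lemma bounded_dual_iso :
  normal_category B /\ normal_isomorphic B FD.
Proof.
have [G Gbij Gincl] : exists2 G : functor B FD, fully_bijective G &
    forall (F F' : B) (s : hom F F'), incl (fmap G s) <-> incl s.
  apply: (functor_of_relation (R := transposes)).
  - exact: coord_space_inj.
  - exact: coord_space_surj.
  - exact: transposes_total.
  - exact: transposes_fun.
  - exact: transposes_surj.
  - exact: transposes_inj.
  - by move=> F c g psi phi phiE x; rewrite app_id phiE.
  - move=> F F' F'' s s' t t' st s't' c g psi phi phiE x.
    by rewrite app_comp (s't' c (s c g) psi)// => y; exact: st.
  - exact: transposes_incl.
split; first exact: normal_transport Gbij Gincl (fd_normal sep').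
by exists G; split=> [|F F' s /Gincl//]; exact: cat_iso_of_bij.
Qed.


End BoundedDual.

(** * Hilbert spaces *)

Section Hilbert.
Variables (K : numFieldType) (theta : K -> K) (H : hilbert theta).
Hypothesis theta0 : theta 0 = 0.
Notation "''[' x , y ]" := (hilb_dot H x y).

(** Cauchy-Schwarz: [a *: y] is the orthogonal projection of [x] on [y]. *)
Lemma hilb_dot_bound (x y : H) : `|'[x, y]| <= `|y| * `|x|.
Proof.
have [->|yN0] := eqVneq y 0; first by rewrite linear0r !normr0 mul0r.
have yy0 : '[y, y] != 0 by rewrite -hilb_norm expf_neq0// normr_eq0.
pose a := '[x, y] / '[y, y]; pose z := x - a *: y.
have zy : '[z, y] = 0.
  by rewrite linearBl /= linearZl_LR /= divfK// subrr.
have yz : '[y, z] = 0.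
  have -> : '[y, z] = (-1) ^+ false * theta '[z, y].
    exact: hermitian_subproof.
  by rewrite zy theta0 mulr0.
have xx : `|x| ^+ 2 = `|z| ^+ 2 + `|a *: y| ^+ 2.
  have zw : '[z, a *: y] = 0 by rewrite linearZr_LR /= zy mulr0.
  have wz : '[a *: y, z] = 0 by rewrite linearZl_LR /= yz mulr0.
  have pythagoras u v : '[u, v] = 0 -> '[v, u] = 0 ->
      '[u + v, u + v] = '[u, u] + '[v, v].
    by move=> uv vu; rewrite linearDl !linearDr /= uv vu addr0 add0r.
  by rewrite !hilb_norm -pythagoras// subrK.
have ayx : `|a *: y| <= `|x|.
  rewrite -(@ler_pXn2r _ 2) ?nnegrE// xx.
  by rewrite lerDr exprn_ge0.
have -> : '[x, y] = a * '[y, y] by rewrite divfK.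
rewrite -hilb_norm normrM normrX normr_id expr2 mulrA mulrC.
by rewrite ler_wpM2l// -normrZ.
Qed.

(** The functional <-, x> takes the value |x|^2 at [x]. *)
Lemma hilb_dual_separated (x : H) : (forall phi : dual H, phi x = 0) -> x = 0.
Proof.
move=> x0.
have [||y|phi phiE] := @dual_ex _ _ (fun y : H => '[y, x]) `|x|.
- exact: normr_real.
- by move=> a u v; rewrite linearPl.
- exact: hilb_dot_bound.
have := x0 phi; rewrite phiE -hilb_norm => /eqP.
by rewrite expf_eq0 normr_eq0 => /eqP.
Qed.

End Hilbert.

Theorem theorem2 (R : realType) :
  (forall H : real_hilbert R,
     normal_category (bounded_dual H) /\
     normal_isomorphic (bounded_dual H) (fd_icat (dual H))) /\
  (forall H : complex_hilbert R,
     normal_category (bounded_dual H) /\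
     normal_isomorphic (bounded_dual H) (fd_icat (dual H))).
Proof.
split=> H; apply: bounded_dual_iso; apply: hilb_dual_separated => //.
exact: rmorph0.
Qed.
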